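(* Fix a dimension $d\ge 2$. The KB-splines $KB_{n,j}$, $j=1,\dots,nd$, are dense in $C([0,1]^d)$ when $n\to\infty$, in the sense that for every $f\in C([0,1]^d)$ and every $\epsilon>0$ there exist an integer $n\ge 1$ and real coefficients $c_1,\dots,c_{dn}$ such that $$\left|f(x_1,\dots,x_d)-\sum_{i=1}^{dn}c_i\,KB_{n,i}(x_1,\dots,x_d)\right|\le\epsilon\quad\text{for all }(x_1,\dots,x_d)\in[0,1]^d.$$
   Context: Kolmogorov superposition theorem (KST), Lorentz version: there exist irrational numbers $0<\lambda_i\le 1$, $i=1,\dots,d$, and strictly increasing Lip($\alpha$) functions $\phi_q:[0,1]\to[0,1]$, $q=0,\dots,2d$ (with $\alpha=\log_{10}2$), such that every $f\in C([0,1]^d)$ can be written as $f(x_1,\dots,x_d)=\sum_{q=0}^{2d} g\left(\sum_{i=1}^d\lambda_i\phi_q(x_i)\right)$ with a continuous function $g$ on $[0,d]$. These $\lambda_i,\phi_q$ are fixed. Let $0=t_1<t_2<\dots<t_{dn}<d$ be the uniform partition of $[0,d]$ with $t_i=(i-1)/n$, and let $b_{n,i}$ be the linear B-splines (hat functions) $b_{n,i}(t)=\max(0,1-n|t-t_i|)$, $t\in[0,d]$, $i=1,\dots,dn$. The KB-splines are $$KB_{n,j}(x_1,\dots,x_d)=\sum_{q=0}^{2d} b_{n,j}\left(\sum_{i=1}^d\lambda_i\phi_q(x_i)\right),\quad j=1,\dots,dn.$$ *)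

(* Defs.v *)
From HB Require Import structures.
From mathcomp Require Import all_boot all_order all_algebra.
From mathcomp Require Import all_classical all_reals all_analysis.

Set Implicit Arguments.
Unset Strict Implicit.
Unset Printing Implicit Defensive.

Import Order.TTheory GRing.Theory Num.Theory.
Import numFieldNormedType.Exports.

Local Open Scope classical_set_scope.
Local Open Scope ring_scope.

Definition unit_cube (R : realType) (d : nat) : set 'rV[R]_d :=
  [set x : 'rV[R]_d | forall i : 'I_d, 0 <= x ord0 i <= 1].

Definition inner (R : realType) (d : nat) (lambda : 'I_d -> R)
    (phi : 'I_(2 * d).+1 -> R -> R) (q : 'I_(2 * d).+1) (x : 'rV[R]_d) : R :=
  \sum_(i < d) lambda i * phi q (x ord0 i).

(* A function with domain [0, 1], [0, d] or [0, 1]^d is represented by a total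
   function, of which only the restriction to that domain is constrained. *)
Record lorentz_kst (R : realType) (d : nat) (lambda : 'I_d -> R)
    (phi : 'I_(2 * d).+1 -> R -> R) : Prop := LorentzKST {
  kst_irrational : forall i, irrational (lambda i) ;
  kst_lambda : forall i, 0 < lambda i <= 1 ;
  kst_range : forall q (x : R), 0 <= x <= 1 -> 0 <= phi q x <= 1 ;
  kst_increasing : forall q (x y : R),
    0 <= x <= 1 -> 0 <= y <= 1 -> x < y -> phi q x < phi q y ;
  (* Lip(alpha) with alpha = log_10 2 *)
  kst_lip : forall q, exists M : R, forall x y : R,
    0 <= x <= 1 -> 0 <= y <= 1 ->
    `|phi q x - phi q y| <= M * `|x - y| `^ (ln 2 / ln 10) ;
  kst_superposition : forall f : 'rV[R]_d -> R,
    {within @unit_cube R d, continuous f} ->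
    exists g : R -> R, {within `[0, d%:R], continuous g} /\
      forall x, unit_cube x ->
        f x = \sum_(q < (2 * d).+1) g (inner lambda phi q x)
}.

(* Indices are 1-based: i ranges over 1, ..., d * n, so the last knot is
   d - 1 / n < d. *)
Definition knot (R : realType) (n i : nat) : R := (i%:R - 1) / n%:R.

Definition hat (R : realType) (n i : nat) (t : R) : R :=
  Num.max 0 (1 - n%:R * `|t - knot R n i|).

Definition KB (R : realType) (d : nat) (lambda : 'I_d -> R)
    (phi : 'I_(2 * d).+1 -> R -> R) (n j : nat) (x : 'rV[R]_d) : R :=
  \sum_(q < (2 * d).+1) hat n j (inner lambda phi q x).

(* Main.v *)
Require Import Defs.
From HB Require Import structures.
From mathcomp Require Import all_boot all_order all_algebra.
From mathcomp Require Import all_classical all_reals all_analysis.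
From mathcomp Require Import ring lra.

Set Implicit Arguments.
Unset Strict Implicit.
Unset Printing Implicit Defensive.

Import Order.TTheory GRing.Theory Num.Theory.
Import numFieldNormedType.Exports.

Local Open Scope classical_set_scope.
Local Open Scope ring_scope.

(** Superposition turns the multivariate problem into a univariate one: write
    [f x] as the sum over [q] of [g] at the point [inner lambda phi q x] of
    [[0, d]], and approximate [g] alone.

    Take [c i] to be the value of [g] at the knot [i].  The combination of the
    hat functions with these coefficients is the piecewise linear interpolant
    of [g]; as the hats are nonnegative, sum to 1 ([sum_hat]) and each vanishes
    at distance at least [1 / n] from its knot, the interpolant is within the
    oscillation of [g] at scale [1 / n] ([hat_interpolation]), which tends to 0
    because [g] is uniformly continuous on [[0, d]]
    ([compact_within_unif_continuous]).  Exchanging the sums over [q] and over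
    the knots gives the same approximation of [f] by KB-splines, with the error
    multiplied by the number [2 d + 1] of inner functions.

    The one obstacle is the right end: the last knot is [d - 1 / n], and the
    hats no longer sum to 1 beyond it, so the interpolant of [g] does not
    approximate [g] near [d].  But [lambda i] is irrational, hence different
    from 1, so the points [inner lambda phi q x] stay below the sum of the
    [lambda i], which is smaller than [d] ([sum_lambda_lt]).  Once [1 / n] is
    less than the gap, no such point lies beyond the last knot. *)

(** The covering form of compactness is applied to the family, indexed by
    [delta] tending to [0^'+], of the points at which [delta] works for [eps]:
    near each point of [A], all small [delta] work. *)
Lemma compact_within_unif_continuous (R : realType) (A : set R) (g : R -> R) :
  compact A -> {within A, continuous g} ->
  forall eps, 0 < eps -> \forall delta \near 0^'+,
    forall x y, A x -> A y -> `|x - y| < delta -> `|g x - g y| <= eps.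
Proof.
move=> /compact_near_coveringP cptA /subspace_continuousP ctsg eps eps0.
have cover := cptA R 0^'+ (fun delta x => forall y, A x -> A y ->
  `|x - y| < delta -> `|g x - g y| <= eps) _.
suff near_x x : A x -> \forall x' \near x & delta \near 0^'+,
    forall y, A x' -> A y -> `|x' - y| < delta -> `|g x' - g y| <= eps.
  by apply: filterS (cover _ near_x) => delta Adelta x y Ax; exact: Adelta.
move=> Ax; have eps20 : 0 < eps / 2 by rewrite divr_gt0.
have /cvgrPdist_lt /(_ _ eps20) := ctsg x Ax.
rewrite near_withinE => /nbhs_ballP[r /= r0 gr].
exists (ball x (r / 2), [set delta | delta < r / 2]).
  split=> /=; first by apply: nbhsx_ballx; rewrite divr_gt0.
  by apply: nbhs_right_lt; rewrite divr_gt0.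
move=> [x' delta] /= [xx' deltar] y Ax' Ay x'y.
have gx' : `|g x - g x'| < eps / 2.
  by apply: gr => //=; apply: le_ball xx'; rewrite ler_pdivrMr; lra.
have gy : `|g x - g y| < eps / 2.
  apply: gr => //=; rewrite /ball /=; move: xx'; rewrite /ball /= => xx'.
  by rewrite (le_lt_trans (ler_distD x' _ _))//; lra.
by rewrite (le_trans (ler_distD (g x) _ _))// (distrC (g x')); lra.
Qed.

(** A hat is the difference of two consecutive translates of the ramp that
    rises from 0 to 1 on [[0, 1]], so a sum of consecutive hats telescopes. *)
Definition ramp (R : realType) (u : R) : R := Num.min 1 (Num.max 0 u).

Lemma ramp_ge1 (R : realType) (u : R) : 1 <= u -> ramp u = 1.
Proof. by move=> u1; rewrite /ramp max_r ?min_l //; lra. Qed.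

Lemma ramp_le0 (R : realType) (u : R) : u <= 0 -> ramp u = 0.
Proof. by move=> u0; rewrite /ramp max_l ?min_r. Qed.

Lemma rampB (R : realType) (u : R) :
  ramp (u + 1) - ramp u = Num.max 0 (1 - `|u|).
Proof.
rewrite /ramp !maxEle !minEle; case: (ger0P u) => u0;
  by do ! case: ifPn; rewrite -?ltNge => *; lra.
Qed.

Lemma hatE (R : realType) (n i : nat) (t : R) : (0 < n)%N ->
  hat n i.+1 t = ramp (n%:R * t - i%:R + 1) - ramp (n%:R * t - i%:R).
Proof.
move=> n0; have n0R : 0 < n%:R :> R by rewrite ltr0n.
rewrite rampB /hat /knot; congr (Num.max 0 (1 - _)).
rewrite -[X in X * _](gtr0_norm n0R) -normrM; congr `|_|.
by rewrite -natr1; field; rewrite gt_eqF.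
Qed.

Lemma hat_ge0 (R : realType) (n i : nat) (t : R) : 0 <= hat n i t.
Proof. by rewrite /hat le_max lexx. Qed.

Lemma hat_eq0 (R : realType) (n i : nat) (t : R) : (0 < n)%N ->
  n%:R^-1 <= `|t - knot R n i| -> hat n i t = 0.
Proof.
move=> n0; rewrite -[n%:R^-1]mul1r ler_pdivrMr ?ltr0n// mulrC => far.
by apply/max_idPl; rewrite subr_le0.
Qed.

Lemma sum_hat (R : realType) (n N : nat) (t : R) :
  (0 < n)%N -> 0 <= t <= knot R n N -> \sum_(1 <= i < N.+1) hat n i t = 1.
Proof.
move=> n0 /andP[t0 tN]; have n0R : 0 < n%:R :> R by rewrite ltr0n.
have nt0 : 0 <= n%:R * t by rewrite mulr_ge0// ltW.
have ntN : n%:R * t <= N%:R - 1.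
  by move: tN; rewrite /knot ler_pdivlMr// mulrC.
rewrite big_add1 /=.
transitivity (\sum_(0 <= i < N)
    ((- ramp (n%:R * t - i.+1%:R + 1)) - (- ramp (n%:R * t - i%:R + 1)))).
  apply: eq_bigr => i _; rewrite hatE// opprK [RHS]addrC; congr (_ - ramp _).
  by rewrite -natr1; ring.
rewrite telescope_sumr// opprK ramp_le0; last by lra.
by rewrite ramp_ge1 ?oppr0 ?add0r//; lra.
Qed.

(** By [sum_hat] the error is the combination of the differences
    [g t - g (knot i)] with weights summing to 1, and the weight is zero unless
    the knot is within [1 / n] of [t]. *)
Lemma hat_interpolation (R : realType) (g : R -> R) (n N : nat) (t eps : R) :
  (0 < n)%N -> 0 <= t <= knot R n N ->
  (forall i, (1 <= i <= N)%N -> `|t - knot R n i| < n%:R^-1 ->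
    `|g t - g (knot R n i)| <= eps) ->
  `|g t - \sum_(1 <= i < N.+1) g (knot R n i) * hat n i t| <= eps.
Proof.
move=> n0 tN g_osc; have hat1 := sum_hat n0 tN.
rewrite -[g t]mulr1 -[in g t * _]hat1 mulr_sumr -sumrB.
rewrite (le_trans (ler_norm_sum _ _ _))//.
rewrite -[leRHS]mulr1 -[in leRHS]hat1 mulr_sumr.
rewrite big_nat [leRHS]big_nat; apply: ler_sum => i iN.
rewrite -mulrBl normrM (ger0_norm (hat_ge0 _ _ _)).
have [near_t|far] := ltP `|t - knot R n i| n%:R^-1.
  by rewrite ler_wpM2r ?hat_ge0// g_osc.
by rewrite hat_eq0// !mulr0.
Qed.

Lemma knot_itv (R : realType) (d n i : nat) :
  (0 < n)%N -> (1 <= i <= d * n)%N -> 0 <= knot R n i <= d%:R.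
Proof.
move=> n0 /andP[i1 idn]; have n0R : 0 < n%:R :> R by rewrite ltr0n.
have i1R : 1 <= i%:R :> R by rewrite ler1n.
have idnR : i%:R <= d%:R * n%:R :> R by rewrite -natrM ler_nat.
by rewrite /knot divr_ge0 ?subr_ge0 ?ler0n//= ler_pdivrMr//; lra.
Qed.

(** An irrational number is not 1, so each [lambda i] is strictly below 1. *)
Lemma sum_lambda_lt (R : realType) (d : nat) (lambda : 'I_d -> R) :
  (0 < d)%N -> (forall i, irrational (lambda i)) ->
  (forall i, lambda i <= 1) -> \sum_(i < d) lambda i < d%:R.
Proof.
move=> d0 irr le1; rewrite -[d in d%:R]card_ord -sumr_const.
apply: ltr_sum => [|i _]; first by apply/hasP; exists (Ordinal d0); rewrite ?mem_index_enum.
rewrite lt_neqAle le1 andbT; apply/eqP => lambda1; apply: (irr i).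
by exists 1; rewrite // rmorph1.
Qed.

Lemma inner_itv (R : realType) (d : nat) (lambda : 'I_d -> R)
    (phi : 'I_(2 * d).+1 -> R -> R) (q : 'I_(2 * d).+1) (x : 'rV[R]_d) :
  (forall i, 0 <= lambda i) ->
  (forall y : R, 0 <= y <= 1 -> 0 <= phi q y <= 1) -> unit_cube x ->
  0 <= inner lambda phi q x <= \sum_(i < d) lambda i.
Proof.
move=> lambda0 phi01 x01; apply/andP; split.
  apply: sumr_ge0 => i _; have /andP[phi0 _] := phi01 _ (x01 i).
  exact: mulr_ge0.
apply: ler_sum => i _; have /andP[_ phi1] := phi01 _ (x01 i).
exact: ler_piMr.
Qed.

Theorem theorem11 (R : realType) (d : nat) (hd : (2 <= d)%N)
    (lambda : 'I_d -> R) (phi : 'I_(2 * d).+1 -> R -> R)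
    (kst : lorentz_kst lambda phi)
    (f : 'rV[R]_d -> R) (hf : {within @unit_cube R d, continuous f})
    (eps : R) (heps : 0 < eps) :
  exists n : nat, (1 <= n)%N /\
    exists c : nat -> R, forall x : 'rV[R]_d, unit_cube x ->
      `|f x - \sum_(1 <= i < (d * n).+1) c i * KB lambda phi n i x| <= eps.
Proof.
have [irr lambda01 phi01 _ _ superposition] := kst.
have [g [ctsg fE]] := superposition f hf.
have lambda0 i : 0 <= lambda i by have /andP[/ltW] := lambda01 i.
have lambda_lt : \sum_(i < d) lambda i < d%:R.
  apply: sum_lambda_lt => // [|i]; first exact: ltn_trans hd.
  by have /andP[] := lambda01 i.
have inner01 q x : unit_cube x -> 0 <= inner lambda phi q x <= \sum_(i < d) lambda i.
  by apply: inner_itv => // y; apply: phi01.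
set e := eps / (2 * d).+1%:R.
have e0 : 0 < e by rewrite divr_gt0// ltr0n.
have unif := compact_within_unif_continuous (@segment_compact R 0 d%:R) ctsg e0.
have gap : 0 < d%:R - \sum_(i < d) lambda i by rewrite subr_gt0.
have [delta [delta0 delta_gap delta_osc]] : exists delta, [/\ 0 < delta,
    delta < d%:R - \sum_(i < d) lambda i &
    forall x y, x \in `[0, d%:R] -> y \in `[0, d%:R] -> `|x - y| < delta ->
      `|g x - g y| <= e].
  apply: (@filter_ex _ (0^'+ : set_system R)).
  near=> delta; split; near: delta;
    [exact: nbhs_right_gt | exact: nbhs_right_lt | exact: unif].
have [k] := ltr_add_invr delta0; rewrite add0r.
set n := k.+1 => n_delta.
exists n; split=> //; exists (fun i => g (knot R n i)) => x x01.
rewrite fE//.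
under [X in _ - X]eq_bigr do rewrite /KB mulr_sumr.
rewrite exchange_big /= -sumrB (le_trans (ler_norm_sum _ _ _))//.
rewrite (_ : eps = \sum_(q < (2 * d).+1) e); last first.
  by rewrite sumr_const card_ord -mulr_natr /e divfK.
apply: ler_sum => q _; have /andP[inner0 inner_le] := inner01 q x x01.
have knot_last : knot R n (d * n) = d%:R - n%:R^-1.
  by rewrite /knot natrM mulrBl div1r mulfK ?pnatr_eq0.
apply: hat_interpolation => //.
  by rewrite inner0 knot_last; lra.
move=> i idn near_knot; apply: delta_osc.
- by rewrite in_itv /= inner0; lra.
- by rewrite in_itv /= knot_itv.
- exact: lt_trans n_delta.
Unshelve. all: by end_near.
Qed.
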